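(* Let $P=k\{x_1,x_2,\ldots,x_n\}$ be the free Poisson algebra over a field $k$ in the variables $x_1,x_2,\ldots,x_n$ and let $P^e$ be its universal enveloping algebra. Then the following statements are true: (i) The subalgebra $A$ (with identity) of $P^e$ generated by $h_{x_1},h_{x_2},\ldots,h_{x_n}$ is the free associative algebra in the variables $h_{x_1},h_{x_2},\ldots,h_{x_n}$; (ii) $P^e$ and $P\otimes_k A$ are isomorphic as left modules over the commutative associative algebra $P$.
   Context: $k$ is a field of characteristic $0$. A Poisson algebra over $k$ is a vector space $P$ with a bilinear multiplication $x\cdot y$ making it a commutative associative algebra (here always with identity $1$) and a bilinear bracket $\{x,y\}$ making it a Lie algebra, such that $\{x,yz\}=\{x,y\}z+y\{x,z\}$. $k\{x_1,\ldots,x_n\}$ is the free such algebra on $x_1,\ldots,x_n$. For a Poisson algebra $P$, the universal enveloping algebra $P^e$ is the associative unital $k$-algebra generated by two copies $m_P=\{m_a: a\in P\}$, $h_P=\{h_a: a\in P\}$ of the vector space $P$ (with $a\mapsto m_a$, $a\mapsto h_a$ linear) subject to the relations, for all $x,y\in P$: $m_{xy}=m_xm_y$, $h_{\{x,y\}}=h_xh_y-h_yh_x$, $h_{xy}=m_yh_x+m_xh_y$, $m_{\{x,y\}}=h_xm_y-m_yh_x$, $m_1=1$. The map $x\mapsto m_x$ is injective and $m_x$ is identified with $x$, so $P\subseteq P^e$; the left $P$-module structure on $P^e$ is left multiplication by elements of $P$, and that on $P\otimes_kA$ is multiplication on the first factor. *)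

(* Defs.v *)
From HB Require Import structures.
From mathcomp Require Import all_boot all_order all_algebra generic_quotient.
From mathcomp Require Import boolp monalg.

Set Implicit Arguments.
Unset Strict Implicit.
Unset Printing Implicit Defensive.

Import GRing.Theory.
Local Open Scope ring_scope.
Local Open Scope quotient_scope.

(* Quotient by a Prop-valued equivalence, made boolean by the classical axioms
   of boolp. *)
Section PropQuotient.
Variables (T : choiceType) (e : T -> T -> Prop).
Hypotheses (er : forall x, e x x) (es : forall x y, e x y -> e y x).
Hypothesis et : forall x y z, e x y -> e y z -> e x z.

Let eb x y := `[< e x y >].

Lemma prop_equiv_refl : reflexive eb.
Proof. by move=> x; apply/asboolP. Qed.

Lemma prop_equiv_sym : symmetric eb.
Proof. by move=> x y; apply/asboolP/asboolP => /es. Qed.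

Lemma prop_equiv_trans : transitive eb.
Proof. by move=> y x z /asboolP xy /asboolP yz; apply/asboolP/(et xy). Qed.

Definition prop_equiv : equiv_rel T :=
  EquivRelPack (EquivClass prop_equiv_refl prop_equiv_sym prop_equiv_trans).

Lemma prop_equivP x y : x = y %[mod {eq_quot prop_equiv}] <-> e x y.
Proof. by split=> [/eqmodP/asboolP|/asboolP H]; last exact/eqmodP. Qed.

End PropQuotient.

(* Every comAlgType, hence every Poisson algebra below, has 1 != 0. *)
HB.mixin Record ComAlgebra_isPoisson (k : fieldType) P of GRing.ComAlgebra k P := {
  bracket : P -> P -> P;
  bracket_linearl : forall y : P, linear (bracket^~ y);
  bracket_linearr : forall x : P, linear (bracket x);
  bracketxx : forall x : P, bracket x x = 0;
  bracket_jacobi : forall x y z : P,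
    bracket x (bracket y z) + bracket y (bracket z x)
      + bracket z (bracket x y) = 0;
  bracket_leibniz : forall x y z : P,
    bracket x (y * z) = bracket x y * z + y * bracket x z
}.

#[short(type="poissonType")]
HB.structure Definition Poisson (k : fieldType) :=
  { P of GRing.ComAlgebra k P & ComAlgebra_isPoisson k P }.

Section PoissonTheory.
Variables (k : fieldType) (P : poissonType k).
Implicit Types x y z : P.

Lemma bracketDl x y z : bracket (x + y) z = bracket x z + bracket y z.
Proof. by have := bracket_linearl z 1 x y; rewrite /= !scale1r. Qed.

Lemma bracketDr x y z : bracket x (y + z) = bracket x y + bracket x z.
Proof. by have := bracket_linearr x 1 y z; rewrite !scale1r. Qed.

Lemma bracket0r x : bracket x 0 = 0.
Proof. by apply: (addrI (bracket x 0)); rewrite -bracketDr !addr0. Qed.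

Lemma bracket0l x : bracket 0 x = 0.
Proof. by apply: (addrI (bracket 0 x)); rewrite -bracketDl !addr0. Qed.

Lemma bracketZl c x y : bracket (c *: x) y = c *: bracket x y.
Proof. by have := bracket_linearl y c x 0; rewrite /= bracket0l !addr0. Qed.

Lemma bracketZr c x y : bracket x (c *: y) = c *: bracket x y.
Proof. by have := bracket_linearr x c y 0; rewrite /= bracket0r !addr0. Qed.

Lemma bracketC x y : bracket x y = - bracket y x.
Proof.
apply/eqP; rewrite -addr_eq0; apply/eqP.
have := bracketxx (x + y).
by rewrite bracketDl !bracketDr !bracketxx addr0 add0r.
Qed.

Lemma bracketNr x y : bracket x (- y) = - bracket x y.
Proof. by rewrite -scaleN1r bracketZr scaleN1r. Qed.

Lemma bracket_leibnizl x y z :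
  bracket (x * y) z = y * bracket x z + x * bracket y z.
Proof.
rewrite bracketC bracket_leibniz opprD (bracketC x z) (bracketC y z).
by rewrite !mulrN mulrC.
Qed.

End PoissonTheory.

Definition poisson_morphism (k : fieldType) (P Q : poissonType k)
    (f : {lrmorphism P -> Q}) : Prop :=
  forall x y, f (bracket x y) = bracket (f x) (f y).

(* PConst c stands for c.1; it provides 0, 1, scaling and opposite. *)
Inductive pterm (k : Type) (n : nat) : Type :=
  | PVar of 'I_n
  | PConst of k
  | PAdd of pterm k n & pterm k n
  | PMul of pterm k n & pterm k n
  | PBracket of pterm k n & pterm k n.
Arguments PVar {k n}.
Arguments PConst {k n}.

HB.instance Definition _ k n := gen_eqMixin (pterm k n).
HB.instance Definition _ k n := gen_choiceMixin (pterm k n).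

Inductive pterm_eq (k : fieldType) (n : nat) : pterm k n -> pterm k n -> Prop :=
  | peq_refl s : pterm_eq s s
  | peq_sym s t : pterm_eq s t -> pterm_eq t s
  | peq_trans s t u : pterm_eq s t -> pterm_eq t u -> pterm_eq s u
  | peq_add s s' t t' : pterm_eq s s' -> pterm_eq t t' ->
      pterm_eq (PAdd s t) (PAdd s' t')
  | peq_mul s s' t t' : pterm_eq s s' -> pterm_eq t t' ->
      pterm_eq (PMul s t) (PMul s' t')
  | peq_bracket s s' t t' : pterm_eq s s' -> pterm_eq t t' ->
      pterm_eq (PBracket s t) (PBracket s' t')
  | peq_constD a b : pterm_eq (PConst (a + b)) (PAdd (PConst a) (PConst b))
  | peq_constM a b : pterm_eq (PConst (a * b)) (PMul (PConst a) (PConst b))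
  | peq_addA s t u : pterm_eq (PAdd s (PAdd t u)) (PAdd (PAdd s t) u)
  | peq_addC s t : pterm_eq (PAdd s t) (PAdd t s)
  | peq_add0 s : pterm_eq (PAdd (PConst 0) s) s
  | peq_mulA s t u : pterm_eq (PMul s (PMul t u)) (PMul (PMul s t) u)
  | peq_mulC s t : pterm_eq (PMul s t) (PMul t s)
  | peq_mul1 s : pterm_eq (PMul (PConst 1) s) s
  | peq_mul0 s : pterm_eq (PMul (PConst 0) s) (PConst 0)
  | peq_mulDl s t u : pterm_eq (PMul (PAdd s t) u) (PAdd (PMul s u) (PMul t u))
  | peq_brDl s t u :
      pterm_eq (PBracket (PAdd s t) u) (PAdd (PBracket s u) (PBracket t u))
  | peq_brDr s t u :
      pterm_eq (PBracket s (PAdd t u)) (PAdd (PBracket s t) (PBracket s u))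
  | peq_brZl c s t :
      pterm_eq (PBracket (PMul (PConst c) s) t) (PMul (PConst c) (PBracket s t))
  | peq_brZr c s t :
      pterm_eq (PBracket s (PMul (PConst c) t)) (PMul (PConst c) (PBracket s t))
  | peq_brxx s : pterm_eq (PBracket s s) (PConst 0)
  | peq_jacobi s t u :
      pterm_eq (PAdd (PAdd (PBracket s (PBracket t u))
                           (PBracket t (PBracket u s)))
                     (PBracket u (PBracket s t)))
               (PConst 0)
  | peq_leibniz s t u :
      pterm_eq (PBracket s (PMul t u))
               (PAdd (PMul (PBracket s t) u) (PMul t (PBracket s u))).

Section FreePoisson.
Variables (k : fieldType) (n : nat).
Local Notation term := (pterm k n).

Definition freePoisson :=
  {eq_quot (prop_equiv (@peq_refl k n) (@peq_sym k n) (@peq_trans k n))}.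

HB.instance Definition _ := Choice.on freePoisson.

Definition fp_pi (t : term) : freePoisson := \pi_freePoisson t.

Lemma fp_piP s t : fp_pi s = fp_pi t <-> pterm_eq s t.
Proof. exact: prop_equivP. Qed.

Lemma fp_reprK (x : freePoisson) : fp_pi (repr x) = x.
Proof. exact: reprK. Qed.

Lemma fp_repr_pi t : pterm_eq (repr (fp_pi t)) t.
Proof. by apply/fp_piP; rewrite fp_reprK. Qed.

Lemma fp_ind (Q : freePoisson -> Prop) : (forall t, Q (fp_pi t)) -> forall x, Q x.
Proof. by move=> H x; rewrite -(fp_reprK x). Qed.

Definition fp_var (i : 'I_n) : freePoisson := fp_pi (PVar i).
Definition fp_const (c : k) : freePoisson := fp_pi (PConst c).
Definition fp_add (x y : freePoisson) := fp_pi (PAdd (repr x) (repr y)).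
Definition fp_mul (x y : freePoisson) := fp_pi (PMul (repr x) (repr y)).
Definition fp_bracket (x y : freePoisson) := fp_pi (PBracket (repr x) (repr y)).
Definition fp_scale c (x : freePoisson) := fp_mul (fp_const c) x.
Definition fp_opp (x : freePoisson) := fp_scale (- 1) x.

Lemma fp_addE s t : fp_add (fp_pi s) (fp_pi t) = fp_pi (PAdd s t).
Proof. by apply/fp_piP/peq_add; exact: fp_repr_pi. Qed.

Lemma fp_mulE s t : fp_mul (fp_pi s) (fp_pi t) = fp_pi (PMul s t).
Proof. by apply/fp_piP/peq_mul; exact: fp_repr_pi. Qed.

Lemma fp_bracketE s t : fp_bracket (fp_pi s) (fp_pi t) = fp_pi (PBracket s t).
Proof. by apply/fp_piP/peq_bracket; exact: fp_repr_pi. Qed.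

Local Definition fpE := (fp_addE, fp_mulE, fp_bracketE).

Lemma fp_addA : associative fp_add.
Proof.
move=> + + z; elim/fp_ind: z => u; elim/fp_ind => s; elim/fp_ind => t.
by rewrite !fpE; apply/fp_piP/peq_addA.
Qed.

Lemma fp_addC : commutative fp_add.
Proof.
by elim/fp_ind => s; elim/fp_ind => t; rewrite !fpE; apply/fp_piP/peq_addC.
Qed.

Lemma fp_add0 : left_id (fp_const 0) fp_add.
Proof. by elim/fp_ind => s; rewrite !fpE; apply/fp_piP/peq_add0. Qed.

Lemma fp_mulA : associative fp_mul.
Proof.
move=> + + z; elim/fp_ind: z => u; elim/fp_ind => s; elim/fp_ind => t.
by rewrite !fpE; apply/fp_piP/peq_mulA.
Qed.

Lemma fp_mulC : commutative fp_mul.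
Proof.
by elim/fp_ind => s; elim/fp_ind => t; rewrite !fpE; apply/fp_piP/peq_mulC.
Qed.

Lemma fp_mul1 : left_id (fp_const 1) fp_mul.
Proof. by elim/fp_ind => s; rewrite !fpE; apply/fp_piP/peq_mul1. Qed.

Lemma fp_mulDl : left_distributive fp_mul fp_add.
Proof.
move=> + + z; elim/fp_ind: z => u; elim/fp_ind => s; elim/fp_ind => t.
by rewrite !fpE; apply/fp_piP/peq_mulDl.
Qed.

Lemma fp_constD a b : fp_const (a + b) = fp_add (fp_const a) (fp_const b).
Proof. by rewrite !fpE; apply/fp_piP/peq_constD. Qed.

Lemma fp_constM a b : fp_const (a * b) = fp_mul (fp_const a) (fp_const b).
Proof. by rewrite !fpE; apply/fp_piP/peq_constM. Qed.

Lemma fp_addN : left_inverse (fp_const 0) fp_opp fp_add.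
Proof.
move=> x; rewrite /fp_opp /fp_scale -{2}(fp_mul1 x) -fp_mulDl -fp_constD addNr.
by elim/fp_ind: x => s; rewrite !fpE; apply/fp_piP/peq_mul0.
Qed.

Fixpoint pterm_aug (t : term) : k :=
  match t with
  | PVar _ => 0
  | PConst c => c
  | PAdd s t => pterm_aug s + pterm_aug t
  | PMul s t => pterm_aug s * pterm_aug t
  | PBracket _ _ => 0
  end.

Lemma pterm_aug_eq s t : pterm_eq s t -> pterm_aug s = pterm_aug t.
Proof.
elim=> //= *; rewrite ?mulr0 ?mul0r ?addr0 ?add0r ?mul1r ?mulrDl //; try congruence.
- exact: addrA.
- exact: addrC.
- exact: mulrA.
- exact: mulrC.
Qed.

Lemma fp_oner_neq0 : fp_const 1 != fp_const 0.
Proof. by apply/eqP => /fp_piP/pterm_aug_eq/eqP; rewrite /= oner_eq0. Qed.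

HB.instance Definition _ :=
  GRing.isZmodule.Build freePoisson fp_addA fp_addC fp_add0 fp_addN.

HB.instance Definition _ :=
  GRing.Zmodule_isComNzRing.Build freePoisson
    fp_mulA fp_mulC fp_mul1 fp_mulDl fp_oner_neq0.

Lemma fp_scaleA a b x : fp_scale a (fp_scale b x) = fp_scale (a * b) x.
Proof. by rewrite /fp_scale fp_mulA -fp_constM. Qed.

Lemma fp_scale1 : left_id 1 fp_scale.
Proof. exact: fp_mul1. Qed.

Lemma fp_scaleDr : right_distributive fp_scale +%R.
Proof. by move=> a x y; exact: (mulrDr (fp_const a)). Qed.

Lemma fp_scaleDl x : {morph fp_scale^~ x : a b / a + b}.
Proof. by move=> a b; rewrite /fp_scale fp_constD; exact: mulrDl. Qed.

HB.instance Definition _ :=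
  GRing.Zmodule_isLmodule.Build k freePoisson
    fp_scaleA fp_scale1 fp_scaleDr fp_scaleDl.

Lemma fp_scaleAl (a : k) (x y : freePoisson) : a *: (x * y) = a *: x * y.
Proof. exact: mulrA. Qed.

HB.instance Definition _ :=
  GRing.Lmodule_isLalgebra.Build k freePoisson fp_scaleAl.
HB.instance Definition _ := GRing.Lalgebra_isComAlgebra.Build k freePoisson.

Lemma fp_piD s t : fp_pi (PAdd s t) = fp_pi s + fp_pi t.
Proof. by rewrite -fp_addE. Qed.

Lemma fp_piM s t : fp_pi (PMul s t) = fp_pi s * fp_pi t.
Proof. by rewrite -fp_mulE. Qed.

Lemma fp_piZ c s : fp_pi (PMul (PConst c) s) = c *: fp_pi s.
Proof. by rewrite -fp_mulE. Qed.

Lemma fp_bracket_linearl y : linear (fp_bracket^~ y).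
Proof.
move=> c x x'; elim/fp_ind: y => t; elim/fp_ind: x => s; elim/fp_ind: x' => s'.
rewrite -fp_piZ -fp_piD !fp_bracketE -fp_piZ -fp_piD; apply/fp_piP.
apply: peq_trans (peq_brDl _ _ _) _.
by apply: peq_add; [apply: peq_brZl | apply: peq_refl].
Qed.

Lemma fp_bracket_linearr x : linear (fp_bracket x).
Proof.
move=> c y y'; elim/fp_ind: x => s; elim/fp_ind: y => t; elim/fp_ind: y' => t'.
rewrite -fp_piZ -fp_piD !fp_bracketE -fp_piZ -fp_piD; apply/fp_piP.
apply: peq_trans (peq_brDr _ _ _) _.
by apply: peq_add; [apply: peq_brZr | apply: peq_refl].
Qed.

Lemma fp_bracketxx x : fp_bracket x x = 0.
Proof. by elim/fp_ind: x => s; rewrite fpE; apply/fp_piP/peq_brxx. Qed.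

Lemma fp_jacobi x y z :
  fp_bracket x (fp_bracket y z) + fp_bracket y (fp_bracket z x)
    + fp_bracket z (fp_bracket x y) = 0.
Proof.
elim/fp_ind: x => s; elim/fp_ind: y => t; elim/fp_ind: z => u.
by rewrite !fp_bracketE -!fp_piD; apply/fp_piP/peq_jacobi.
Qed.

Lemma fp_leibniz x y z :
  fp_bracket x (y * z) = fp_bracket x y * z + y * fp_bracket x z.
Proof.
elim/fp_ind: x => s; elim/fp_ind: y => t; elim/fp_ind: z => u.
by rewrite -fp_piM !fp_bracketE -!fp_piM -fp_piD; apply/fp_piP/peq_leibniz.
Qed.

HB.instance Definition _ :=
  ComAlgebra_isPoisson.Build k freePoisson fp_bracket_linearl
    fp_bracket_linearr fp_bracketxx fp_jacobi fp_leibniz.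

Section Lift.
Variables (Q : poissonType k) (y : 'I_n -> Q).

Fixpoint pterm_eval (t : term) : Q :=
  match t with
  | PVar i => y i
  | PConst c => c%:A
  | PAdd s t => pterm_eval s + pterm_eval t
  | PMul s t => pterm_eval s * pterm_eval t
  | PBracket s t => bracket (pterm_eval s) (pterm_eval t)
  end.

Lemma pterm_eval_eq s t : pterm_eq s t -> pterm_eval s = pterm_eval t.
Proof.
elim=> //=; try by move=> *; congruence.
- by move=> a b; rewrite scalerDl.
- by move=> a b; rewrite mulr_algl scalerA.
- by move=> *; rewrite addrA.
- by move=> *; rewrite addrC.
- by move=> *; rewrite scale0r add0r.
- by move=> *; rewrite mulrA.
- by move=> *; rewrite mulrC.
- by move=> *; rewrite scale1r mul1r.
- by move=> *; rewrite scale0r mul0r.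
- by move=> *; rewrite mulrDl.
- by move=> *; rewrite bracketDl.
- by move=> *; rewrite bracketDr.
- by move=> *; rewrite !mulr_algl bracketZl.
- by move=> *; rewrite !mulr_algl bracketZr.
- by move=> *; rewrite bracketxx scale0r.
- by move=> *; rewrite bracket_jacobi scale0r.
- by move=> *; rewrite bracket_leibniz.
Qed.

Definition fp_lift (x : freePoisson) : Q := pterm_eval (repr x).

Lemma fp_lift_pi t : fp_lift (fp_pi t) = pterm_eval t.
Proof. exact/pterm_eval_eq/fp_repr_pi. Qed.

Lemma fp_lift_linear : linear fp_lift.
Proof.
move=> c x x'; elim/fp_ind: x => s; elim/fp_ind: x' => s'.
by rewrite -fp_piZ -fp_piD !fp_lift_pi /= mulr_algl.
Qed.

Lemma fp_lift_monoid : monoid_morphism fp_lift.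
Proof.
split=> [|x x']; first by rewrite /GRing.one /= fp_lift_pi /= scale1r.
elim/fp_ind: x => s; elim/fp_ind: x' => s'.
by rewrite -fp_piM !fp_lift_pi.
Qed.

HB.instance Definition _ := GRing.isLinear.Build k freePoisson Q *:%R
  fp_lift fp_lift_linear.
HB.instance Definition _ := GRing.isMonoidMorphism.Build freePoisson Q
  fp_lift fp_lift_monoid.

End Lift.

Theorem freePoisson_universal (Q : poissonType k) (y : 'I_n -> Q) :
  exists f : {lrmorphism freePoisson -> Q},
    [/\ poisson_morphism f, forall i, f (fp_var i) = y i
      & forall g : {lrmorphism freePoisson -> Q},
          poisson_morphism g -> (forall i, g (fp_var i) = y i) -> g =1 f].
Proof.
exists (fp_lift y : {lrmorphism _ -> _}); split=> /=.
- move=> x x'; elim/fp_ind: x => s; elim/fp_ind: x' => s'.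
  by rewrite /bracket /= fp_bracketE !fp_lift_pi.
- by move=> i; rewrite fp_lift_pi.
move=> g gP gy; elim/fp_ind; elim=> [i|c|s IHs t IHt|s IHs t IHt|s IHs t IHt].
- by rewrite gy fp_lift_pi.
- have -> : fp_pi (PConst c) = c%:A by rewrite /GRing.scale /= /fp_scale -fp_constM mulr1.
  by rewrite !rmorph_alg.
- by rewrite fp_piD !raddfD /= -IHs -IHt.
- by rewrite fp_piM !rmorphM /= -IHs -IHt.
- have pi_br : fp_pi (PBracket s t) = bracket (fp_pi s) (fp_pi t).
    by rewrite /bracket /= fp_bracketE.
  by rewrite [in LHS]pi_br gP IHs IHt !fp_lift_pi.
Qed.

End FreePoisson.

(* EConst c stands for c.1, as in pterm; EM x and EH x stand for m_x and h_x. *)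
Inductive eterm (k P : Type) : Type :=
  | EM of P
  | EH of P
  | EConst of k
  | EAdd of eterm k P & eterm k P
  | EMul of eterm k P & eterm k P.
Arguments EM {k P}.
Arguments EH {k P}.
Arguments EConst {k P}.

HB.instance Definition _ k P := gen_eqMixin (eterm k P).
HB.instance Definition _ k P := gen_choiceMixin (eterm k P).

Inductive eterm_eq (k : fieldType) (P : poissonType k) :
    eterm k P -> eterm k P -> Prop :=
  | eeq_refl s : eterm_eq s s
  | eeq_sym s t : eterm_eq s t -> eterm_eq t s
  | eeq_trans s t u : eterm_eq s t -> eterm_eq t u -> eterm_eq s u
  | eeq_add s s' t t' : eterm_eq s s' -> eterm_eq t t' ->
      eterm_eq (EAdd s t) (EAdd s' t')
  | eeq_mul s s' t t' : eterm_eq s s' -> eterm_eq t t' ->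
      eterm_eq (EMul s t) (EMul s' t')
  | eeq_constD a b : eterm_eq (EConst (a + b)) (EAdd (EConst a) (EConst b))
  | eeq_constM a b : eterm_eq (EConst (a * b)) (EMul (EConst a) (EConst b))
  | eeq_constC c s : eterm_eq (EMul (EConst c) s) (EMul s (EConst c))
  | eeq_addA s t u : eterm_eq (EAdd s (EAdd t u)) (EAdd (EAdd s t) u)
  | eeq_addC s t : eterm_eq (EAdd s t) (EAdd t s)
  | eeq_add0 s : eterm_eq (EAdd (EConst 0) s) s
  | eeq_mulA s t u : eterm_eq (EMul s (EMul t u)) (EMul (EMul s t) u)
  | eeq_mul1 s : eterm_eq (EMul (EConst 1) s) s
  | eeq_mul0 s : eterm_eq (EMul (EConst 0) s) (EConst 0)
  | eeq_mulDl s t u : eterm_eq (EMul (EAdd s t) u) (EAdd (EMul s u) (EMul t u))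
  | eeq_mulDr s t u : eterm_eq (EMul s (EAdd t u)) (EAdd (EMul s t) (EMul s u))
  (* linearity of m and h, then the defining relations of P^e *)
  | eeq_mD (x y : P) : eterm_eq (EM (x + y)) (EAdd (EM x) (EM y))
  | eeq_mZ c (x : P) : eterm_eq (EM (c *: x)) (EMul (EConst c) (EM x))
  | eeq_hD (x y : P) : eterm_eq (EH (x + y)) (EAdd (EH x) (EH y))
  | eeq_hZ c (x : P) : eterm_eq (EH (c *: x)) (EMul (EConst c) (EH x))
  | eeq_mM (x y : P) : eterm_eq (EM (x * y)) (EMul (EM x) (EM y))
  | eeq_h_bracket (x y : P) :
      eterm_eq (EH (bracket x y))
        (EAdd (EMul (EH x) (EH y)) (EMul (EConst (- 1)) (EMul (EH y) (EH x))))
  | eeq_hM (x y : P) :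
      eterm_eq (EH (x * y)) (EAdd (EMul (EM y) (EH x)) (EMul (EM x) (EH y)))
  | eeq_m_bracket (x y : P) :
      eterm_eq (EM (bracket x y))
        (EAdd (EMul (EH x) (EM y)) (EMul (EConst (- 1)) (EMul (EM y) (EH x))))
  | eeq_m1 : eterm_eq (EM 1) (EConst 1).

Section Envelope.
Variables (k : fieldType) (P : poissonType k).
Local Notation term := (eterm k P).

Definition envelope :=
  {eq_quot (prop_equiv (@eeq_refl k P) (@eeq_sym k P) (@eeq_trans k P))}.

HB.instance Definition _ := Choice.on envelope.

Definition env_pi (t : term) : envelope := \pi_envelope t.

Lemma env_piP s t : env_pi s = env_pi t <-> eterm_eq s t.
Proof. exact: prop_equivP. Qed.

Lemma env_reprK (x : envelope) : env_pi (repr x) = x.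
Proof. exact: reprK. Qed.

Lemma env_repr_pi t : eterm_eq (repr (env_pi t)) t.
Proof. by apply/env_piP; rewrite env_reprK. Qed.

Lemma env_ind (Q : envelope -> Prop) : (forall t, Q (env_pi t)) -> forall x, Q x.
Proof. by move=> H x; rewrite -(env_reprK x). Qed.

Definition env_m (x : P) : envelope := env_pi (EM x).
Definition env_h (x : P) : envelope := env_pi (EH x).
Definition env_const (c : k) : envelope := env_pi (EConst c).
Definition env_add (x y : envelope) := env_pi (EAdd (repr x) (repr y)).
Definition env_mul (x y : envelope) := env_pi (EMul (repr x) (repr y)).
Definition env_scale c (x : envelope) := env_mul (env_const c) x.
Definition env_opp (x : envelope) := env_scale (- 1) x.

Lemma env_addE s t : env_add (env_pi s) (env_pi t) = env_pi (EAdd s t).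
Proof. by apply/env_piP/eeq_add; exact: env_repr_pi. Qed.

Lemma env_mulE s t : env_mul (env_pi s) (env_pi t) = env_pi (EMul s t).
Proof. by apply/env_piP/eeq_mul; exact: env_repr_pi. Qed.

Local Definition envE := (env_addE, env_mulE).

Lemma env_addA : associative env_add.
Proof.
move=> + + z; elim/env_ind: z => u; elim/env_ind => s; elim/env_ind => t.
by rewrite !envE; apply/env_piP/eeq_addA.
Qed.

Lemma env_addC : commutative env_add.
Proof.
by elim/env_ind => s; elim/env_ind => t; rewrite !envE; apply/env_piP/eeq_addC.
Qed.

Lemma env_add0 : left_id (env_const 0) env_add.
Proof. by elim/env_ind => s; rewrite !envE; apply/env_piP/eeq_add0. Qed.

Lemma env_mulA : associative env_mul.
Proof.
move=> + + z; elim/env_ind: z => u; elim/env_ind => s; elim/env_ind => t.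
by rewrite !envE; apply/env_piP/eeq_mulA.
Qed.

Lemma env_constC c x : env_mul (env_const c) x = env_mul x (env_const c).
Proof. by elim/env_ind: x => s; rewrite !envE; apply/env_piP/eeq_constC. Qed.

Lemma env_mul1 : left_id (env_const 1) env_mul.
Proof. by elim/env_ind => s; rewrite !envE; apply/env_piP/eeq_mul1. Qed.

Lemma env_mulr1 : right_id (env_const 1) env_mul.
Proof. by move=> x; rewrite -env_constC env_mul1. Qed.

Lemma env_mulDl : left_distributive env_mul env_add.
Proof.
move=> + + z; elim/env_ind: z => u; elim/env_ind => s; elim/env_ind => t.
by rewrite !envE; apply/env_piP/eeq_mulDl.
Qed.

Lemma env_mulDr : right_distributive env_mul env_add.
Proof.
move=> + + z; elim/env_ind: z => u; elim/env_ind => s; elim/env_ind => t.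
by rewrite !envE; apply/env_piP/eeq_mulDr.
Qed.

Lemma env_constD a b : env_const (a + b) = env_add (env_const a) (env_const b).
Proof. by rewrite !envE; apply/env_piP/eeq_constD. Qed.

Lemma env_constM a b : env_const (a * b) = env_mul (env_const a) (env_const b).
Proof. by rewrite !envE; apply/env_piP/eeq_constM. Qed.

Lemma env_addN : left_inverse (env_const 0) env_opp env_add.
Proof.
move=> x; rewrite /env_opp /env_scale -{2}(env_mul1 x) -env_mulDl -env_constD.
by rewrite addNr; elim/env_ind: x => s; rewrite !envE; apply/env_piP/eeq_mul0.
Qed.

(* P is a P^e-module, with m_x acting by x * _ and h_x by {x, _}. *)
Fixpoint eterm_act (t : term) : P -> P :=
  match t with
  | EM x => fun z => x * z
  | EH x => fun z => bracket x z
  | EConst c => fun z => c *: z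
  | EAdd s t => fun z => eterm_act s z + eterm_act t z
  | EMul s t => fun z => eterm_act s (eterm_act t z)
  end.

Lemma eterm_act_linear t : linear (eterm_act t).
Proof.
elim: t => [x|x|b|s IHs t IHt|s IHs t IHt] c z z' /=.
- by rewrite mulrDr scalerAr.
- by rewrite bracketDr bracketZr.
- by rewrite scalerDr !scalerA mulrC.
- by rewrite IHs IHt scalerDr addrACA.
- by rewrite IHt IHs.
Qed.

Lemma eterm_act_eq s t : eterm_eq s t -> eterm_act s =1 eterm_act t.
Proof.
have lin0 u : eterm_act u 0 = 0.
  apply: (addrI (eterm_act u 0)).
  by have := eterm_act_linear u 1 0 0; rewrite !scale1r !addr0.
have linD u a b : eterm_act u (a + b) = eterm_act u a + eterm_act u b.
  by have := eterm_act_linear u 1 a b; rewrite !scale1r.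
have linZ u c a : eterm_act u (c *: a) = c *: eterm_act u a.
  by have := eterm_act_linear u c a 0; rewrite lin0 !addr0.
elim=> //=.
- by move=> u v _ IH z; rewrite IH.
- by move=> u v w _ IH1 _ IH2 z; rewrite IH1 IH2.
- by move=> u u' v v' _ IH1 _ IH2 z; rewrite IH1 IH2.
- by move=> u u' v v' _ IH1 _ IH2 z; rewrite IH2 IH1.
- by move=> a b z; rewrite scalerDl.
- by move=> a b z; rewrite scalerA.
- by move=> c u z; rewrite linZ.
- by move=> u v w z; rewrite addrA.
- by move=> u v z; rewrite addrC.
- by move=> u z; rewrite scale0r add0r.
- by move=> u z; rewrite scale1r.
- by move=> u z; rewrite !scale0r.
- by move=> u v w z; rewrite linD.
- by move=> x y z; rewrite mulrDl.
- by move=> c x z; rewrite scalerAl.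
- by move=> x y z; rewrite bracketDl.
- by move=> c x z; rewrite bracketZl.
- by move=> x y z; rewrite mulrA.
- move=> x y z; rewrite scaleN1r (bracketC x z) bracketNr opprK bracketC.
  by apply/esym/eqP; rewrite -addr_eq0 bracket_jacobi.
- by move=> x y z; rewrite bracket_leibnizl.
- by move=> x y z; rewrite scaleN1r bracket_leibniz addrK.
- by move=> z; rewrite mul1r scale1r.
Qed.

Lemma env_oner_neq0 : env_const 1 != env_const 0.
Proof.
apply/eqP => /env_piP/eterm_act_eq/(_ 1)/eqP.
by rewrite /= scale1r scale0r oner_eq0.
Qed.

HB.instance Definition _ :=
  GRing.isZmodule.Build envelope env_addA env_addC env_add0 env_addN.

HB.instance Definition _ :=
  GRing.Zmodule_isNzRing.Build envelope
    env_mulA env_mul1 env_mulr1 env_mulDl env_mulDr env_oner_neq0.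

Lemma env_scaleA a b x : env_scale a (env_scale b x) = env_scale (a * b) x.
Proof. by rewrite /env_scale env_mulA -env_constM. Qed.

Lemma env_scale1 : left_id 1 env_scale.
Proof. exact: env_mul1. Qed.

Lemma env_scaleDr : right_distributive env_scale +%R.
Proof. by move=> a x y; exact: (mulrDr (env_const a)). Qed.

Lemma env_scaleDl x : {morph env_scale^~ x : a b / a + b}.
Proof. by move=> a b; rewrite /env_scale env_constD; exact: mulrDl. Qed.

HB.instance Definition _ :=
  GRing.Zmodule_isLmodule.Build k envelope
    env_scaleA env_scale1 env_scaleDr env_scaleDl.

Lemma env_scaleAl (a : k) (x y : envelope) : a *: (x * y) = a *: x * y.
Proof. exact: mulrA. Qed.

HB.instance Definition _ := GRing.Lmodule_isLalgebra.Build k envelope env_scaleAl.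

Lemma env_scaleAr (a : k) (x y : envelope) : a *: (x * y) = x * (a *: y).
Proof.
have scE (z : envelope) : a *: z = z * env_const a by exact: env_constC.
by rewrite !scE mulrA.
Qed.

HB.instance Definition _ := GRing.Lalgebra_isAlgebra.Build k envelope env_scaleAr.

Lemma env_piD s t : env_pi (EAdd s t) = env_pi s + env_pi t.
Proof. by rewrite -env_addE. Qed.

Lemma env_piM s t : env_pi (EMul s t) = env_pi s * env_pi t.
Proof. by rewrite -env_mulE. Qed.

Lemma env_piZ c s : env_pi (EMul (EConst c) s) = c *: env_pi s.
Proof. by rewrite -env_mulE. Qed.

Lemma env_m_linear : linear env_m.
Proof.
move=> c x y; rewrite /env_m -env_piZ -env_piD; apply/env_piP.
apply: eeq_trans (eeq_mD _ _) _.
by apply: eeq_add; [exact: eeq_mZ | exact: eeq_refl].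
Qed.

Lemma env_h_linear : linear env_h.
Proof.
move=> c x y; rewrite /env_h -env_piZ -env_piD; apply/env_piP.
apply: eeq_trans (eeq_hD _ _) _.
by apply: eeq_add; [exact: eeq_hZ | exact: eeq_refl].
Qed.

Lemma env_m_monoid : monoid_morphism env_m.
Proof.
split=> [|x y]; first by apply/env_piP/eeq_m1.
by rewrite /env_m -env_piM; apply/env_piP/eeq_mM.
Qed.

HB.instance Definition _ := GRing.isLinear.Build k P envelope *:%R env_m env_m_linear.
HB.instance Definition _ := GRing.isMonoidMorphism.Build P envelope env_m env_m_monoid.
HB.instance Definition _ := GRing.isLinear.Build k P envelope *:%R env_h env_h_linear.

Lemma env_h_bracket x y : env_h (bracket x y) = env_h x * env_h y - env_h y * env_h x.
Proof.
rewrite -scaleN1r /env_h -!env_piM -env_piZ -env_piD.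
exact/env_piP/eeq_h_bracket.
Qed.

Lemma env_hM x y : env_h (x * y) = env_m y * env_h x + env_m x * env_h y.
Proof. by rewrite /env_h /env_m -!env_piM -env_piD; apply/env_piP/eeq_hM. Qed.

Lemma env_m_bracket x y : env_m (bracket x y) = env_h x * env_m y - env_m y * env_h x.
Proof.
rewrite -scaleN1r /env_h /env_m -!env_piM -env_piZ -env_piD.
exact/env_piP/eeq_m_bracket.
Qed.

Section Lift.
Variables (B : algType k) (m h : {linear P -> B}).

Fixpoint eterm_eval (t : term) : B :=
  match t with
  | EM x => m x
  | EH x => h x
  | EConst c => c%:A
  | EAdd s t => eterm_eval s + eterm_eval t
  | EMul s t => eterm_eval s * eterm_eval t
  end.

Hypotheses (mM : forall x y, m (x * y) = m x * m y)
  (h_br : forall x y, h (bracket x y) = h x * h y - h y * h x)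
  (hM : forall x y, h (x * y) = m y * h x + m x * h y)
  (m_br : forall x y, m (bracket x y) = h x * m y - m y * h x)
  (m1 : m 1 = 1).

Lemma eterm_eval_eq s t : eterm_eq s t -> eterm_eval s = eterm_eval t.
Proof using mM h_br hM m_br m1.
elim=> //=; try by move=> *; congruence.
- by move=> a b; rewrite scalerDl.
- by move=> a b; rewrite mulr_algl scalerA.
- by move=> c u; rewrite mulr_algl mulr_algr.
- by move=> *; rewrite addrA.
- by move=> *; rewrite addrC.
- by move=> *; rewrite scale0r add0r.
- by move=> *; rewrite mulrA.
- by move=> *; rewrite scale1r mul1r.
- by move=> *; rewrite scale0r mul0r.
- by move=> *; rewrite mulrDl.
- by move=> *; rewrite mulrDr.
- by move=> *; rewrite linearD.
- by move=> *; rewrite linearZ mulr_algl.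
- by move=> *; rewrite linearD.
- by move=> *; rewrite linearZ mulr_algl.
- by move=> x y; rewrite h_br mulr_algl scaleN1r.
- by move=> x y; rewrite m_br mulr_algl scaleN1r.
- by rewrite m1 scale1r.
Qed.

Theorem envelope_universal :
  exists f : {lrmorphism envelope -> B},
    [/\ forall x, f (env_m x) = m x, forall x, f (env_h x) = h x
      & forall g : {lrmorphism envelope -> B},
          (forall x, g (env_m x) = m x) -> (forall x, g (env_h x) = h x) ->
          g =1 f].
Proof using mM h_br hM m_br m1.
pose f (x : envelope) := eterm_eval (repr x).
have f_pi t : f (env_pi t) = eterm_eval t by exact/eterm_eval_eq/env_repr_pi.
have flin : linear f.
  move=> c x y; elim/env_ind: x => s; elim/env_ind: y => t.
  by rewrite -env_piZ -env_piD !f_pi /= mulr_algl.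
have fmon : monoid_morphism f.
  split=> [|x y]; first by rewrite /GRing.one /= f_pi /= scale1r.
  elim/env_ind: x => s; elim/env_ind: y => t.
  by rewrite -env_piM !f_pi.
pose fL := GRing.isLinear.Build k envelope B *:%R f flin.
pose fM := GRing.isMonoidMorphism.Build envelope B f fmon.
pose F : {lrmorphism envelope -> B} := HB.pack f fL fM.
exists F; split=> [x|x|g gm gh]; rewrite ?[LHS]f_pi //.
elim/env_ind; elim=> [x|x|c|s IHs t IHt|s IHs t IHt]; rewrite [RHS]f_pi.
- exact: gm.
- exact: gh.
- have -> : env_pi (EConst c) = c%:A.
    by rewrite /GRing.scale /= /env_scale -env_constM mulr1.
  by rewrite rmorph_alg.
- by rewrite env_piD raddfD /= IHs IHt [in LHS]/= !f_pi.
- by rewrite env_piM rmorphM /= IHs IHt [in LHS]/= !f_pi.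
Qed.

End Lift.

(* The carrier of P^e with the left P-module structure given by left
   multiplication through m; its default module structure is the one over k. *)
Definition envelope_mod : Type := envelope.

HB.instance Definition _ := GRing.Zmodule.on envelope_mod.

Definition env_modscale (p : P) (u : envelope_mod) : envelope_mod :=
  env_m p * (u : envelope).

Lemma env_modscaleA p q u :
  env_modscale p (env_modscale q u) = env_modscale (p * q) u.
Proof. by rewrite /env_modscale mulrA -rmorphM. Qed.

Lemma env_modscale1 : left_id 1 env_modscale.
Proof. by move=> u; rewrite /env_modscale rmorph1 mul1r. Qed.

Lemma env_modscaleDr : right_distributive env_modscale +%R.
Proof. by move=> p u v; rewrite /env_modscale mulrDr. Qed.

Lemma env_modscaleDl u : {morph env_modscale^~ u : p q / p + q}.
Proof. by move=> p q; rewrite /env_modscale raddfD mulrDl. Qed.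

HB.instance Definition _ :=
  GRing.Zmodule_isLmodule.Build P envelope_mod
    env_modscaleA env_modscale1 env_modscaleDr env_modscaleDl.

End Envelope.

Section GeneratedSubalgebra.
Variables (k : fieldType) (U : algType k) (I : Type) (g : I -> U).

Definition in_gen_subalg : {pred U} := fun u =>
  `[< forall B : {pred U}, subalg_closed B -> (forall i, g i \in B) -> u \in B >].

Lemma in_gen_subalgP u :
  reflect (forall B : {pred U}, subalg_closed B -> (forall i, g i \in B) -> u \in B)
    (u \in in_gen_subalg).
Proof. exact: asboolP. Qed.

Lemma gen_in_subalg i : g i \in in_gen_subalg.
Proof. by apply/in_gen_subalgP => B _; apply. Qed.

Lemma in_gen_subalg_closed : subalg_closed in_gen_subalg.
Proof.
split=> [|a u v /in_gen_subalgP Su /in_gen_subalgP Sv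
         |u v /in_gen_subalgP Su /in_gen_subalgP Sv];
  apply/in_gen_subalgP => B cB gB; have [B1 BL BM] := cB.
- exact: B1.
- by apply: BL; [exact: Su | exact: Sv].
- by apply: BM; [exact: Su | exact: Sv].
Qed.

HB.instance Definition _ := GRing.isSubalgClosed.Build k U in_gen_subalg
  (GRing.subalg_closed_semi in_gen_subalg_closed).

Record gen_subalg : predArgType := GenSubalg {
  gen_subalg_val :> U;
  gen_subalg_valP : gen_subalg_val \in in_gen_subalg
}.

HB.instance Definition _ := [isSub for gen_subalg_val].
HB.instance Definition _ := [Choice of gen_subalg by <:].
HB.instance Definition _ := [SubChoice_isSubAlgebra of gen_subalg by <:].

End GeneratedSubalgebra.

(* Formal sums only form a monoid under concatenation, hence tens_eq_0. *)
Inductive tens_eq (k : fieldType) (P : comAlgType k) (V : lmodType k) :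
    seq (P * V) -> seq (P * V) -> Prop :=
  | tens_eq_refl s : tens_eq s s
  | tens_eq_sym s t : tens_eq s t -> tens_eq t s
  | tens_eq_trans s t u : tens_eq s t -> tens_eq t u -> tens_eq s u
  | tens_eq_cat s s' t t' : tens_eq s s' -> tens_eq t t' ->
      tens_eq (s ++ t) (s' ++ t')
  | tens_eq_catC s t : tens_eq (s ++ t) (t ++ s)
  | tens_eq_0 v : tens_eq [:: (0, v)] [::]
  | tens_eq_Dl p q v : tens_eq [:: (p + q, v)] [:: (p, v); (q, v)]
  | tens_eq_Dr p v w : tens_eq [:: (p, v + w)] [:: (p, v); (p, w)]
  | tens_eq_Z c p v : tens_eq [:: (c *: p, v)] [:: (p, c *: v)].

Section Tensor.
Variables (k : fieldType) (P : comAlgType k) (V : lmodType k).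
Local Notation fsum := (seq (P * V)).

Definition tens :=
  {eq_quot (prop_equiv (@tens_eq_refl k P V) (@tens_eq_sym k P V)
                       (@tens_eq_trans k P V))}.

HB.instance Definition _ := Choice.on tens.

Definition tens_pi (s : fsum) : tens := \pi_tens s.

Lemma tens_piP s t : tens_pi s = tens_pi t <-> tens_eq s t.
Proof. exact: prop_equivP. Qed.

Lemma tens_reprK (x : tens) : tens_pi (repr x) = x.
Proof. exact: reprK. Qed.

Lemma tens_repr_pi s : tens_eq (repr (tens_pi s)) s.
Proof. by apply/tens_piP; rewrite tens_reprK. Qed.

Lemma tens_ind (Q : tens -> Prop) : (forall s, Q (tens_pi s)) -> forall x, Q x.
Proof. by move=> H x; rewrite -(tens_reprK x). Qed.

Definition fsum_scale (p : P) (s : fsum) : fsum := [seq (p * x.1, x.2) | x <- s].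

Lemma fsum_scale_eq p s t : tens_eq s t -> tens_eq (fsum_scale p s) (fsum_scale p t).
Proof.
elim=> [{}s|{}s {}t _|{}s {}t u _ IHs _|s1 s2 t1 t2 _ IHs _ IHt|{}s {}t|v|q r v
       |q v w|c q v].
- exact: tens_eq_refl.
- exact: tens_eq_sym.
- exact: tens_eq_trans.
- by rewrite /fsum_scale !map_cat; apply: tens_eq_cat.
- by rewrite /fsum_scale !map_cat; apply: tens_eq_catC.
- by rewrite /= mulr0; apply: tens_eq_0.
- by rewrite /= mulrDr; apply: tens_eq_Dl.
- exact: tens_eq_Dr.
- by rewrite /= -scalerAr; apply: tens_eq_Z.
Qed.

Definition tensor (p : P) (v : V) : tens := tens_pi [:: (p, v)].
Definition tens_add (x y : tens) := tens_pi (repr x ++ repr y).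
Definition tens_scale (p : P) (x : tens) := tens_pi (fsum_scale p (repr x)).
Definition tens_opp (x : tens) := tens_scale (- 1) x.

Lemma tens_addE s t : tens_add (tens_pi s) (tens_pi t) = tens_pi (s ++ t).
Proof. by apply/tens_piP/tens_eq_cat; exact: tens_repr_pi. Qed.

Lemma tens_scaleE p s : tens_scale p (tens_pi s) = tens_pi (fsum_scale p s).
Proof. by apply/tens_piP/fsum_scale_eq/tens_repr_pi. Qed.

Lemma tens_addA : associative tens_add.
Proof.
move=> + + z; elim/tens_ind: z => u; elim/tens_ind => s; elim/tens_ind => t.
by rewrite !tens_addE catA.
Qed.

Lemma tens_addC : commutative tens_add.
Proof.
elim/tens_ind => s; elim/tens_ind => t; rewrite !tens_addE.
exact/tens_piP/tens_eq_catC.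
Qed.

Lemma tens_add0 : left_id (tens_pi [::]) tens_add.
Proof. by elim/tens_ind => s; rewrite tens_addE. Qed.

Lemma tens_scale1 : left_id 1 tens_scale.
Proof.
elim/tens_ind => s; rewrite tens_scaleE /fsum_scale; congr tens_pi.
by elim: s => //= -[p v] s ->; rewrite mul1r.
Qed.

Lemma tens_scaleA p q x : tens_scale p (tens_scale q x) = tens_scale (p * q) x.
Proof.
elim/tens_ind: x => s; rewrite !tens_scaleE /fsum_scale -map_comp.
by congr tens_pi; apply: eq_map => -[r v] /=; rewrite mulrA.
Qed.

Lemma tens_scaleDr p x y :
  tens_scale p (tens_add x y) = tens_add (tens_scale p x) (tens_scale p y).
Proof.
elim/tens_ind: x => s; elim/tens_ind: y => t.
by rewrite tens_addE !tens_scaleE tens_addE /fsum_scale map_cat.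
Qed.

Lemma tens_scaleDl x p q :
  tens_scale (p + q) x = tens_add (tens_scale p x) (tens_scale q x).
Proof.
elim/tens_ind: x; elim=> [|[r v] s IH]; first by rewrite !tens_scaleE tens_addE.
have cE a : tens_scale a (tens_pi ((r, v) :: s)) =
    tens_add (tens_pi [:: (a * r, v)]) (tens_scale a (tens_pi s)).
  by rewrite !tens_scaleE tens_addE.
rewrite !cE IH mulrDl.
have -> : tens_pi [:: (p * r + q * r, v)] =
    tens_add (tens_pi [:: (p * r, v)]) (tens_pi [:: (q * r, v)]).
  by rewrite tens_addE; apply/tens_piP/tens_eq_Dl.
by rewrite -!tens_addA; congr tens_add; rewrite !tens_addA [in LHS](tens_addC (tens_pi _)).
Qed.

Lemma tens_scale0 x : tens_scale 0 x = tens_pi [::].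
Proof.
elim/tens_ind: x => s; rewrite tens_scaleE; apply/tens_piP.
elim: s => [|[r v] s IH] /=; first exact: tens_eq_refl.
rewrite -[X in tens_eq _ X]cats0 -cat1s mul0r -[X in tens_eq _ X]cat0s.
by apply: tens_eq_cat => //; exact: tens_eq_0.
Qed.

Lemma tens_addN : left_inverse (tens_pi [::]) tens_opp tens_add.
Proof.
by move=> x; rewrite -{2}(tens_scale1 x) -tens_scaleDl addNr tens_scale0.
Qed.

HB.instance Definition _ :=
  GRing.isZmodule.Build tens tens_addA tens_addC tens_add0 tens_addN.

HB.instance Definition _ :=
  GRing.Zmodule_isLmodule.Build P tens
    tens_scaleA tens_scale1 tens_scaleDr tens_scaleDl.

Lemma tensorDl p q v : tensor (p + q) v = tensor p v + tensor q v.
Proof. by rewrite [RHS]tens_addE; apply/tens_piP/tens_eq_Dl. Qed.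

Lemma tensorDr p v w : tensor p (v + w) = tensor p v + tensor p w.
Proof. by rewrite [RHS]tens_addE; apply/tens_piP/tens_eq_Dr. Qed.

Lemma tensorZ c p v : tensor (c *: p) v = tensor p (c *: v).
Proof. exact/tens_piP/tens_eq_Z. Qed.

Lemma scale_tensor p q v : p *: tensor q v = tensor (p * q) v.
Proof. exact: tens_scaleE. Qed.

Theorem tens_universal (W : zmodType) (b : P -> V -> W) :
  (forall p q v, b (p + q) v = b p v + b q v) ->
  (forall p v w, b p (v + w) = b p v + b p w) ->
  (forall c p v, b (c *: p) v = b p (c *: v)) ->
  exists f : {additive tens -> W},
    (forall p v, f (tensor p v) = b p v) /\
    (forall g : {additive tens -> W}, (forall p v, g (tensor p v) = b p v) ->
       g =1 f).
Proof.
move=> bDl bDr bZ.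
pose ev (s : fsum) := \sum_(x <- s) b x.1 x.2.
have ev_eq s t : tens_eq s t -> ev s = ev t.
  rewrite /ev; elim=> //=; try by move=> *; congruence.
  - by move=> s1 s2 t1 t2 _ IHs _ IHt; rewrite !big_cat IHs IHt.
  - by move=> s1 s2; rewrite !big_cat /= addrC.
  - move=> v; rewrite big_seq1 big_nil /=; apply: (addrI (b 0 v)).
    by rewrite -bDl !addr0.
  - by move=> p q v; rewrite !big_cons !big_nil /= !addr0 bDl.
  - by move=> p v w; rewrite !big_cons !big_nil /= !addr0 bDr.
  - by move=> c p v; rewrite !big_seq1 /= bZ.
pose f (x : tens) := ev (repr x).
have f_pi s : f (tens_pi s) = ev s by exact/ev_eq/tens_repr_pi.
have fadd : nmod_morphism f.
  split=> [|x y]; first by rewrite [LHS]f_pi /ev big_nil.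
  elim/tens_ind: x => s; elim/tens_ind: y => t.
  by rewrite [X in f X]tens_addE !f_pi /ev big_cat.
pose fA := GRing.isNmodMorphism.Build tens W f fadd.
pose F : {additive tens -> W} := HB.pack f fA.
exists F; split=> [p v|g gb]; first by rewrite [LHS]f_pi /ev big_seq1.
elim/tens_ind => s; rewrite [RHS]f_pi /ev.
elim: s => [|[p v] s IH]; first by rewrite big_nil -(raddf0 g).
have -> : tens_pi ((p, v) :: s) = tensor p v + tens_pi s by rewrite [RHS]tens_addE.
by rewrite raddfD gb IH big_cons.
Qed.

End Tensor.

(* Main.v *)
(* Let F be the free associative algebra on X_1, ..., X_n and W = P (x) F. The
   space P (+) W is a Poisson algebra for (p,u)(q,v) = (pq, pv + qu) and
   {(p,u),(q,v)} = ({p,q}, {p,v} - {q,u} + uv - vu), so x_i |-> (x_i, X_i)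
   extends to a Poisson morphism p |-> (p, D p) from the free Poisson algebra.
   The identities satisfied by D say exactly that P^e acts on W, m_p by
   multiplication and h_p by {p, _} + D p. Evaluating at 1 maps
   m_p h_(x_i1) ... h_(x_ir) to p X_i1 ... X_ir, and these elements span P^e;
   hence P^e is isomorphic to P (x) F, with F identified with A. *)
Require Import Defs.
From HB Require Import structures.
From mathcomp Require Import all_boot all_order all_algebra generic_quotient.
From mathcomp Require Import finmap monalg ring.
From mathcomp Require boolp.

Set Implicit Arguments.
Unset Strict Implicit.
Unset Printing Implicit Defensive.

Import GRing.Theory.
Local Open Scope ring_scope.

(** * Linear maps out of a monoid algebra *)

Section MonoidAlgebra.
Variables (R : comNzRingType) (K : monomType).
Implicit Types (u v : {malg R[K]}) (m : K).

Lemma malgZU (c d : R) m : c *: << d *g m >> = << c * d *g m >> :> {malg R[K]}.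
Proof. by apply/malgP => m'; rewrite mcoeffZ !mcoeffU mulrnAr. Qed.

Lemma malgUM (c d : R) m m' :
  << c *g m >> * << d *g m' >> = << c * d *g mmul m m' >> :> {malg R[K]}.
Proof. exact: fgmulUU. Qed.

Lemma malg_ind (Q : {malg R[K]} -> Prop) :
  (forall c m, Q << c *g m >>) -> (forall u v, Q u -> Q v -> Q (u + v)) ->
  forall u, Q u.
Proof.
move=> QU QD u; rewrite [u]monalgE; elim/big_rec: _ => [|m v _ Qv].
  (* The empty sum is the monomial [mone] with coefficient 0. *)
  by have := QU 0 mone; rewrite monalgU0.
exact: QD.
Qed.

(** Both sides are biadditive, and on monomials the commutativity of [R] lets the scalar pass. *)
Lemma malg_scalerAr (c : R) u v : c *: (u * v) = u * (c *: v).
Proof.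
elim/malg_ind: u => [d m|u u' IHu IHu']; last first.
  by rewrite mulrDl scalerDr IHu IHu' mulrDl.
elim/malg_ind: v => [e m'|v v' IHv IHv']; last first.
  by rewrite scalerDr !mulrDr scalerDr IHv IHv'.
by rewrite malgUM !malgZU malgUM mulrCA.
Qed.

Section Lift.
Variables (V : lmodType R) (F : K -> V).

Definition malg_lift u : V := \sum_(m <- msupp u) u@_m *: F m.

(** A larger index set adds only zero terms, so sums over different supports can be compared over
    one common set. *)
Lemma malg_liftEw (d : {fset K}) u :
  fsubset (msupp u) d -> malg_lift u = \sum_(m <- d) u@_m *: F m.
Proof.
move=> le; rewrite [LHS](big_fset_incl _ le) => //= m _ /mcoeff_outdom ->.
by rewrite scale0r.
Qed.

Lemma malg_lift_linear : linear malg_lift.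
Proof.
move=> c u v; set d := (msupp u `|` msupp v)%fset.
have le_u : fsubset (msupp u) d by exact: fsubsetUl.
have le_v : fsubset (msupp v) d by exact: fsubsetUr.
have le_cuv : fsubset (msupp (c *: u + v)) d.
  apply: fsubset_trans (msuppD_le _ _) _; rewrite fsubUset le_v andbT.
  exact: fsubset_trans (msuppZ_le _ _) le_u.
rewrite (malg_liftEw le_u) (malg_liftEw le_v) (malg_liftEw le_cuv).
rewrite scaler_sumr -big_split; apply: eq_bigr => m _ /=.
by rewrite mcoeffD mcoeffZ scalerDl scalerA.
Qed.

HB.instance Definition _ :=
  GRing.isLinear.Build R {malg R[K]} V *:%R malg_lift malg_lift_linear.

Lemma malg_liftU c m : malg_lift << c *g m >> = c *: F m.
Proof. by rewrite (malg_liftEw msuppU_le) big_seq_fset1 mcoeffUU. Qed.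

Lemma malg_lift1 m : malg_lift << m >> = F m.
Proof. by rewrite malg_liftU scale1r. Qed.

End Lift.

Lemma eq_malg_linear (V : lmodType R) (f g : {linear {malg R[K]} -> V}) :
  (forall m, f << m >> = g << m >>) -> f =1 g.
Proof.
move=> fg; elim/malg_ind => [c m|u v IHu IHv]; last by rewrite !linearD IHu IHv.
by rewrite -[c]mulr1 -malgZU !linearZ fg.
Qed.

End MonoidAlgebra.

(* The model is P (x) F with der p (q (x) a) = {p, q} (x) a, for an associative
   algebra F over k. *)
HB.mixin Record Lalgebra_isDerAlgebra (k : fieldType) (P : poissonType k) W
    of GRing.Lalgebra P W := {
  dscalerAr : forall (p : P) (u v : W), p *: (u * v) = u * (p *: v);
  der : P -> W -> W;
  derDl : forall (p q : P) (u : W), der (p + q) u = der p u + der q u;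
  derAl : forall (c : k) (p : P) (u : W), der (c *: p) u = c%:A *: der p u;
  derDr : forall (p : P) (u v : W), der p (u + v) = der p u + der p v;
  derZr : forall (p q : P) (u : W), der p (q *: u) = bracket p q *: u + q *: der p u;
  derPl : forall (p q : P) (u : W), der (p * q) u = q *: der p u + p *: der q u;
  derM : forall (p : P) (u v : W), der p (u * v) = der p u * v + u * der p v;
  der_bracket : forall (p q : P) (u : W),
    der (bracket p q) u = der p (der q u) - der q (der p u)
}.

#[short(type="derAlgType")]
HB.structure Definition DerAlgebra (k : fieldType) (P : poissonType k) :=
  { W of GRing.Lalgebra P W & Lalgebra_isDerAlgebra k P W }.

(** The Leibniz rule applied to 1 = 1.1 gives {p, 1} = 2 {p, 1}, hence {p, 1} = 0. *)
Lemma bracket_alg (k : fieldType) (P : poissonType k) (p : P) (c : k) :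
  bracket p c%:A = 0.
Proof.
rewrite bracketZr; suff -> : bracket p 1 = 0 by rewrite scaler0.
apply: (addrI (bracket p 1)).
by rewrite addr0 -[in RHS](mulr1 1) bracket_leibniz mulr1 mul1r.
Qed.

(** * The square-zero extension of [P] by [W] as a Poisson algebra *)

Section DerAlgebraTheory.
Variables (k : fieldType) (P : poissonType k) (W : derAlgType P).
Implicit Types (p q : P) (u v : W).

Lemma der0r p : der p 0 = 0 :> W.
Proof. by apply: (addrI (der p 0)); rewrite -derDr !addr0. Qed.

Lemma derNr p u : der p (- u) = - der p u.
Proof. by apply: (addrI (der p u)); rewrite -derDr !subrr der0r. Qed.

Lemma derAr p (c : k) u : der p (c%:A *: u) = c%:A *: der p u.
Proof. by rewrite derZr bracket_alg scale0r add0r. Qed.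

(* As a commutative algebra, pext is the square-zero extension of P by W; as a
   Lie algebra, it is the semidirect product of P acting on W through der, W
   carrying the commutator bracket. *)
Definition pext : Type := (P * W)%type.
HB.instance Definition _ := GRing.Zmodule.on pext.
Implicit Types x y z : pext.

Definition pext_mul x y : pext := (x.1 * y.1, x.1 *: y.2 + y.1 *: x.2).
(** [W] is given as a module over [P], so [k] acts on it through the constants of [P]. *)
Definition pext_scale (c : k) x : pext := (c *: x.1, c%:A *: x.2).
Definition pext_bracket x y : pext :=
  (bracket x.1 y.1,
   der x.1 y.2 - der y.1 x.2 + (x.2 * y.2 - y.2 * x.2)).

Lemma pext_mulA : associative pext_mul.
Proof.
move=> x y z; congr pair; first by rewrite /= mulrA.
rewrite /= !scalerDr !scalerA -addrA; congr (_ + _).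
by rewrite [z.1 * _]mulrC [z.1 * _]mulrC [y.1 * z.1]mulrC mulrC.
Qed.

Lemma pext_mulC : commutative pext_mul.
Proof. by move=> x y; rewrite /pext_mul mulrC addrC. Qed.

Lemma pext_mul1 : left_id ((1, 0) : pext) pext_mul.
Proof. by case=> p u; rewrite /pext_mul /= mul1r scale1r scaler0 addr0. Qed.

Lemma pext_mulDl : left_distributive pext_mul +%R.
Proof.
move=> x y z; congr pair; first by rewrite /= mulrDl.
by rewrite /= scalerDl scalerDr addrACA.
Qed.

Lemma pext_oner_neq0 : ((1, 0) : pext) != 0.
Proof. by rewrite xpair_eqE oner_eq0. Qed.

HB.instance Definition _ :=
  GRing.Zmodule_isComNzRing.Build pext
    pext_mulA pext_mulC pext_mul1 pext_mulDl pext_oner_neq0.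

Lemma pext_scaleA a b x : pext_scale a (pext_scale b x) = pext_scale (a * b) x.
Proof. by rewrite /pext_scale /= !scalerA mulr_algl scalerA. Qed.

Lemma pext_scale1 : left_id 1 pext_scale.
Proof. by case=> p u; rewrite /pext_scale /= !scale1r. Qed.

Lemma pext_scaleDr : right_distributive pext_scale +%R.
Proof. by move=> a x y; congr pair; rewrite /= scalerDr. Qed.

Lemma pext_scaleDl x : {morph pext_scale^~ x : a b / a + b}.
Proof. by move=> a b; congr pair; rewrite /= !scalerDl. Qed.

HB.instance Definition _ :=
  GRing.Zmodule_isLmodule.Build k pext
    pext_scaleA pext_scale1 pext_scaleDr pext_scaleDl.

Lemma pext_scaleAl (a : k) x y : a *: (x * y) = a *: x * y.
Proof.
congr pair; rewrite /= ?scalerAl // scalerDr !scalerA mulr_algl.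
by rewrite [y.1 * _]mulrC.
Qed.

HB.instance Definition _ := GRing.Lmodule_isLalgebra.Build k pext pext_scaleAl.
HB.instance Definition _ := GRing.Lalgebra_isComAlgebra.Build k pext.

(* Linear identities in W are checked by ring in the commutative ring pext. *)
Definition pext_inr u : pext := (0, u).

Lemma pext_inr_inj : injective pext_inr.
Proof. by move=> u v []. Qed.

Lemma pext_inr0 : pext_inr 0 = 0. Proof. by []. Qed.

Lemma pext_inrD u v : pext_inr (u + v) = pext_inr u + pext_inr v.
Proof. by congr pair; rewrite /= addr0. Qed.

Lemma pext_inrN u : pext_inr (- u) = - pext_inr u.
Proof. by congr pair; rewrite /= oppr0. Qed.

Lemma pext_bracketxx x : pext_bracket x x = 0.
Proof. by congr pair; rewrite /= ?bracketxx // !subrr addr0. Qed.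

Lemma pext_bracketC x y : pext_bracket x y = - pext_bracket y x.
Proof.
congr pair; rewrite /= 1?bracketC //.
by rewrite opprD !opprB.
Qed.

Lemma pext_bracket_linearr x : linear (pext_bracket x).
Proof.
move=> c y z; congr pair; rewrite /= 1?bracketDr ?bracketZr //.
rewrite derDr derAr derDl derAl mulrDr mulrDl.
rewrite -scalerAl -dscalerAr !opprD !scalerDr !scalerN.
by rewrite [RHS]addrACA; congr (_ + _); rewrite addrACA.
Qed.

Lemma pext_bracket_linearl y : linear (pext_bracket^~ y).
Proof.
move=> c x z; rewrite pext_bracketC pext_bracket_linearr opprD.
by rewrite -scalerN -!pext_bracketC.
Qed.

(** In the [W]-component the [der] terms match by [derZr] and [derPl], and the commutator terms
    match because the product of [W] is bilinear over [P]. *)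
Lemma pext_bracket_leibniz x y z :
  pext_bracket x (y * z) = pext_bracket x y * z + y * pext_bracket x z.
Proof.
congr pair; rewrite /= ?bracket_leibniz //.
rewrite derDr !derZr derPl mulrDr mulrDl -!scalerAl -!dscalerAr.
rewrite !scalerDr !scalerN; apply: pext_inr_inj; rewrite !(pext_inrD, pext_inrN); ring.
Qed.

(** This is the Jacobi identity of a semidirect product: [der] is a Lie action by [der_bracket], it
    acts by derivations by [derM], and the commutator satisfies Jacobi by associativity. *)
Lemma pext_jacobi x y z :
  pext_bracket x (pext_bracket y z) + pext_bracket y (pext_bracket z x)
    + pext_bracket z (pext_bracket x y) = 0.
Proof.
congr pair; rewrite /= ?bracket_jacobi //.
rewrite !(derDr, derNr, derM, der_bracket).
rewrite !(mulrDl, mulrDr, mulNr, mulrN) !mulrA.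
by apply: pext_inr_inj; rewrite !(pext_inrD, pext_inrN) pext_inr0; ring.
Qed.

HB.instance Definition _ :=
  ComAlgebra_isPoisson.Build k pext pext_bracket_linearl pext_bracket_linearr
    pext_bracketxx pext_jacobi pext_bracket_leibniz.

End DerAlgebraTheory.

(** * The coefficientwise bracket on a monoid algebra over [P] *)

Section PoissonMonoidAlgebra.
Variables (k : fieldType) (P : poissonType k) (K : monomType).
Local Notation W := {malg P[K]}.
Implicit Types (p q : P) (u v : W).

Definition mbracket p u : W := [malg m in msupp u => bracket p u@_m].

Lemma mbracketE p u m : (mbracket p u)@_m = bracket p u@_m.
Proof. by rewrite mcoeffE; case: msuppP; rewrite ?bracket0r. Qed.

Lemma mbracketDl p q u : mbracket (p + q) u = mbracket p u + mbracket q u.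
Proof. by apply/malgP => m; rewrite mcoeffD !mbracketE bracketDl. Qed.

Lemma mbracketDr p u v : mbracket p (u + v) = mbracket p u + mbracket p v.
Proof. by apply/malgP => m; rewrite mcoeffD !mbracketE mcoeffD bracketDr. Qed.

Lemma mbracketU p q m : mbracket p << q *g m >> = << bracket p q *g m >>.
Proof.
apply/malgP => m'; rewrite mbracketE !mcoeffU.
by case: eqP; rewrite ?mulr1n // !mulr0n bracket0r.
Qed.

(** The coefficient 1 is a constant. Words are thus killed by [der], which is why h_(x_i) will act
    on them as left multiplication by X_i. *)
Lemma mbracketU1 p m : mbracket p << m >> = 0.
Proof. by rewrite mbracketU -[1]scale1r bracket_alg monalgU0. Qed.

Lemma mbracketZr p q u : mbracket p (q *: u) = bracket p q *: u + q *: mbracket p u.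
Proof.
apply/malgP => m.
by rewrite mcoeffD !mcoeffZ !mbracketE mcoeffZ bracket_leibniz.
Qed.

Lemma mbracketAl (c : k) p u : mbracket (c *: p) u = c%:A *: mbracket p u.
Proof. by apply/malgP => m; rewrite mcoeffZ !mbracketE bracketZl mulr_algl. Qed.

Lemma mbracketMl p q u : mbracket (p * q) u = q *: mbracket p u + p *: mbracket q u.
Proof.
apply/malgP => m.
by rewrite mcoeffD !mcoeffZ !mbracketE bracket_leibnizl.
Qed.

Lemma mbracketMr p u v : mbracket p (u * v) = mbracket p u * v + u * mbracket p v.
Proof.
elim/malg_ind: u => [d m|u u' IHu IHu']; last first.
  by rewrite mulrDl !mbracketDr IHu IHu' !mulrDl addrACA.
elim/malg_ind: v => [e m'|v v' IHv IHv']; last first.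
  by rewrite mulrDr !mbracketDr IHv IHv' !mulrDr addrACA.
by rewrite malgUM !mbracketU !malgUM bracket_leibniz monalgUD.
Qed.

Lemma mbracket_bracket p q u :
  mbracket (bracket p q) u = mbracket p (mbracket q u) - mbracket q (mbracket p u).
Proof.
apply/malgP => m; rewrite mcoeffB !mbracketE; apply/eqP.
have := bracket_jacobi p q u@_m.
rewrite (bracketC u@_m p) bracketNr (bracketC u@_m) => /eqP.
by rewrite subr_eq0 eq_sym.
Qed.

HB.instance Definition _ := Lalgebra_isDerAlgebra.Build k P {malg P[K]}
  (@malg_scalerAr P K) mbracketDl mbracketAl mbracketDr mbracketZr mbracketMl
  mbracketMr mbracket_bracket.

End PoissonMonoidAlgebra.

(** * The action of P^e on [W] twisted by [D] *)

Section EnvelopeAction.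
Variables (k : fieldType) (P : poissonType k) (W : derAlgType P) (D : P -> W).
Hypotheses (DD : forall x y, D (x + y) = D x + D y)
  (DZ : forall (c : k) x, D (c *: x) = c%:A *: D x)
  (DM : forall x y, D (x * y) = x *: D y + y *: D x)
  (Dbr : forall x y,
     D (bracket x y) = der x (D y) - der y (D x) + (D x * D y - D y * D x)).

Fixpoint eterm_dact (t : eterm k P) : W -> W :=
  match t with
  | EM x => fun u => x *: u
  | EH x => fun u => der x u + D x * u
  | EConst c => fun u => c%:A *: u
  | EAdd s t => fun u => eterm_dact s u + eterm_dact t u
  | EMul s t => fun u => eterm_dact s (eterm_dact t u)
  end.

Lemma eterm_dactD t u v : eterm_dact t (u + v) = eterm_dact t u + eterm_dact t v.
Proof.
elim: t u v => [x|x|c|s IHs t IHt|s IHs t IHt] u v /=.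
- exact: scalerDr.
- by rewrite derDr mulrDr addrACA.
- exact: scalerDr.
- by rewrite IHs IHt addrACA.
- by rewrite IHt IHs.
Qed.

Lemma eterm_dactZ t (c : k) u : eterm_dact t (c%:A *: u) = c%:A *: eterm_dact t u.
Proof.
elim: t u => [x|x|b|s IHs t IHt|s IHs t IHt] u /=.
- by rewrite !scalerA mulrC.
- by rewrite derAr scalerDr dscalerAr.
- by rewrite !scalerA mulrC.
- by rewrite IHs IHt scalerDr.
- by rewrite IHt IHs.
Qed.

Lemma eterm_dact_eq s t : eterm_eq s t -> eterm_dact s =1 eterm_dact t.
Proof.
have scaleN1A (u : W) : (-1)%:A *: u = - u by rewrite scaleN1r scaleN1r.
elim=> //=.
- by move=> u v _ IH z; rewrite IH.
- by move=> u v w _ IH1 _ IH2 z; rewrite IH1 IH2.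
- by move=> u u' v v' _ IH1 _ IH2 z; rewrite IH1 IH2.
- by move=> u u' v v' _ IH1 _ IH2 z; rewrite IH2 IH1.
- by move=> a b z; rewrite !scalerDl.
- by move=> a b z; rewrite scalerA mulr_algl scalerA.
- by move=> c u z; rewrite eterm_dactZ.
- by move=> u v w z; rewrite addrA.
- by move=> u v z; rewrite addrC.
- by move=> u z; rewrite !scale0r add0r.
- by move=> u z; rewrite !scale1r.
- by move=> u z; rewrite !scale0r.
- by move=> u v w z; rewrite eterm_dactD.
- by move=> x y z; rewrite scalerDl.
- by move=> c x z; rewrite scalerA mulr_algl.
- by move=> x y z; rewrite derDl DD mulrDl addrACA.
- by move=> c x z; rewrite derAl DZ scalerDr scalerAl.
- by move=> x y z; rewrite scalerA.
(* In h_x h_y - h_y h_x the mixed terms [D x * der y z] and [D y * der x z] occur in both products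
   and cancel. *)
- move=> x y z; rewrite scaleN1A der_bracket Dbr !derDr !derM !mulrDr !mulrDl.
  rewrite !mulNr -!mulrA; apply: pext_inr_inj.
  by rewrite !(pext_inrD, pext_inrN); ring.
- move=> x y z; rewrite derPl DM mulrDl !scalerDr -!scalerAl [_ *: (D y * z) + _]addrC.
  by rewrite addrACA.
(* Left multiplication by [D x] commutes with the scalar [y], so only the term {x, y} of the Leibniz
   rule survives. *)
- move=> x y z; rewrite scaleN1A derZr -dscalerAr scalerDr opprD addrACA addrK.
  by rewrite subrr addr0.
- by move=> z; rewrite !scale1r.
Qed.

Definition env_dact (a : envelope P) (u : W) : W := eterm_dact (repr a) u.

Lemma env_dact_pi t : env_dact (env_pi t) =1 eterm_dact t.
Proof. exact/eterm_dact_eq/env_repr_pi. Qed.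

Lemma env_dactDl a b u : env_dact (a + b) u = env_dact a u + env_dact b u.
Proof.
elim/env_ind: a => s; elim/env_ind: b => t.
by rewrite -env_piD !env_dact_pi.
Qed.

Lemma env_dactM a b u : env_dact (a * b) u = env_dact a (env_dact b u).
Proof.
elim/env_ind: a => s; elim/env_ind: b => t.
by rewrite -env_piM !env_dact_pi.
Qed.

Lemma env_dact1 u : env_dact 1 u = u.
Proof. by rewrite env_dact_pi /= !scale1r. Qed.

Lemma env_dact_m x u : env_dact (env_m x) u = x *: u.
Proof. exact: env_dact_pi. Qed.

Lemma env_dact_h x u : env_dact (env_h x) u = der x u + D x * u.
Proof. exact: env_dact_pi. Qed.

Definition env_eval1 (a : envelope_mod P) : W := env_dact a 1.

(** A scalar [p] of [envelope_mod] multiplies by [env_m p], which acts on [W] as [p]. *)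
Lemma env_eval1_linear : linear env_eval1.
Proof.
move=> p a b; rewrite /env_eval1 [LHS]env_dactDl; congr (_ + _).
by rewrite [LHS]env_dactM env_dact_m.
Qed.

End EnvelopeAction.

(** * Algebra morphisms out of the free associative algebra *)

Section FreeAlgebraLift.
Variables (k : fieldType) (I : choiceType) (B : algType k) (g : I -> B).

Definition fmonom_prod (m : {fmonom I}) : B := \prod_(i <- m) g i.

Lemma fmonom_prod1 : fmonom_prod mone = 1.
Proof. by rewrite /fmonom_prod fm1 big_nil. Qed.

Lemma fmonom_prodM m m' :
  fmonom_prod (mmul m m') = fmonom_prod m * fmonom_prod m'.
Proof. by rewrite /fmonom_prod fmM big_cat. Qed.

Lemma fmonom_prodU i : fmonom_prod (fmu i) = g i.
Proof. by rewrite /fmonom_prod fmU big_seq1. Qed.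

Definition free_lift : {malg k[{fmonom I}]} -> B := malg_lift fmonom_prod.

HB.instance Definition _ := GRing.Linear.on free_lift.

Lemma free_lift_monoid : monoid_morphism free_lift.
Proof.
have fD u v : free_lift (u + v) = free_lift u + free_lift v by exact: linearD.
split=> [|u v]; first by rewrite /free_lift malg_lift1 fmonom_prod1.
elim/malg_ind: u => [c m|u u' IHu IHu']; last first.
  rewrite (mulrDl u u') (fD (u * v)) (fD u) (mulrDl (free_lift u)).
  by congr (_ + _); [exact: IHu | exact: IHu'].
elim/malg_ind: v => [d m'|v v' IHv IHv']; last first.
  rewrite (mulrDr _ v v') (fD (_ * v)) (fD v) (mulrDr _ (free_lift v)).
  by congr (_ + _); [exact: IHv | exact: IHv'].
rewrite malgUM /free_lift !malg_liftU fmonom_prodM.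
by rewrite -scalerAl -scalerAr scalerA.
Qed.

HB.instance Definition _ :=
  GRing.isMonoidMorphism.Build {malg k[{fmonom I}]} B free_lift free_lift_monoid.

Lemma free_liftU i : free_lift << fmu i >> = g i.
Proof. by rewrite /free_lift malg_lift1 fmonom_prodU. Qed.

End FreeAlgebraLift.

(** * A generated subalgebra as an image of the free algebra *)

Section GeneratedSubalgebraLift.
Variables (k : fieldType) (I : choiceType) (U : algType k) (g : I -> U).

Definition subalg_gen i : gen_subalg g := GenSubalg (gen_in_subalg g i).

Lemma val_fmonom_prod m : val (fmonom_prod subalg_gen m) = fmonom_prod g m.
Proof. by rewrite /fmonom_prod rmorph_prod. Qed.

(** The image in [U] is a subalgebra that contains the generators, so it contains the smallest such
    subalgebra. *)
Lemma free_lift_surj (a : gen_subalg g) : exists b, free_lift subalg_gen b = a.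
Proof.
pose B : {pred U} := fun u => boolp.asbool (exists b, val (free_lift subalg_gen b) = u).
have cB : subalg_closed B.
  split=> [|c u v /boolp.asboolP[b <-] /boolp.asboolP[b' <-]
           |u v /boolp.asboolP[b <-] /boolp.asboolP[b' <-]]; apply/boolp.asboolP.
  - by exists 1; rewrite !rmorph1.
  - by exists (c *: b + b'); rewrite !linearP.
  - by exists (b * b'); rewrite !rmorphM.
have gB i : g i \in B by apply/boolp.asboolP; exists << fmu i >>; rewrite free_liftU.
have /in_gen_subalgP/(_ B cB gB)/boolp.asboolP[b bE] := gen_subalg_valP a.
by exists b; apply: val_inj.
Qed.

End GeneratedSubalgebraLift.

(** * The map D on the free Poisson algebra *)

Section FreePoissonEnvelope.
Variables (k : fieldType) (n : nat).
Let P : poissonType k := freePoisson k n.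
Let W : derAlgType P := {malg P[{fmonom 'I_n}]}.
Let U : algType k := envelope P.
Implicit Types (p q : P) (u v : W).

Let var (i : 'I_n) : P := fp_var k i.
Let ext_gen (i : 'I_n) : pext W := (var i, << fmu i >>).

Lemma fp_piC (c : k) : fp_pi (PConst c) = c%:A :> P.
Proof. by rewrite /GRing.scale /= /fp_scale -fp_constM mulr1. Qed.

(** The first projection of [pext] respects all operations and sends the generators [ext_gen i] to
    the variables. *)
Lemma fp_lift_ext1 p : (fp_lift ext_gen p).1 = p.
Proof.
elim/fp_ind: p => t; rewrite fp_lift_pi.
elim: t => [i|c|s IHs t IHt|s IHs t IHt|s IHs t IHt] //=.
- by rewrite fp_piC.
- by rewrite fp_piD -IHs -IHt.
- by rewrite fp_piM -IHs -IHt.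
- by rewrite -fp_bracketE -IHs -IHt.
Qed.

(** The identities of [fp_der] below are the second components of the statement that p |-> (p, D p)
    is a Poisson morphism. *)
Definition fp_der p : W := (fp_lift ext_gen p).2.

Lemma fp_derD p q : fp_der (p + q) = fp_der p + fp_der q.
Proof. by rewrite /fp_der linearD. Qed.

Lemma fp_derZ (c : k) p : fp_der (c *: p) = c%:A *: fp_der p.
Proof. by rewrite /fp_der linearZ. Qed.

Lemma fp_derM p q : fp_der (p * q) = p *: fp_der q + q *: fp_der p.
Proof. by rewrite /fp_der rmorphM /= !fp_lift_ext1. Qed.

Lemma fp_der_bracket p q :
  fp_der (bracket p q) = der p (fp_der q) - der q (fp_der p)
    + (fp_der p * fp_der q - fp_der q * fp_der p).
Proof.
have brE : fp_lift ext_gen (bracket p q) =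
    bracket (fp_lift ext_gen p) (fp_lift ext_gen q).
  elim/fp_ind: p => s; elim/fp_ind: q => t.
  by rewrite [in LHS]/bracket /= fp_bracketE !fp_lift_pi.
by rewrite /fp_der brE /= !fp_lift_ext1.
Qed.

Lemma fp_der_var i : fp_der (var i) = << fmu i >>.
Proof. by rewrite /fp_der fp_lift_pi. Qed.

Let h i : U := env_h (var i).

(** The relations express every h_p through the h_(x_i) and the m_q: h_1 = 0, products by [env_hM],
    brackets by commutators. So [S] is a left ideal, and it contains 1. *)
Lemma env_spanning_left_ideal (S : U -> Prop) :
  (forall a b, S a -> S b -> S (a + b)) ->
  (forall p a, S a -> S (env_m p * a)) ->
  (forall i a, S a -> S (h i * a)) ->
  S 1 -> forall a, S a.
Proof.
move=> SD Sm Sh S1.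
have SZ (c : k) a : S a -> S (c *: a).
  by move/(Sm c%:A); rewrite rmorph_alg mulr_algl.
have SB a b : S a -> S b -> S (a - b).
  by move=> Sa Sb; apply: SD => //; rewrite -scaleN1r; apply: SZ.
have h1 : env_h (1 : P) = 0.
  apply: (addrI (env_h 1)); rewrite addr0 -[in RHS](mulr1 1) env_hM.
  by rewrite rmorph1 mul1r.
have SH p a : S a -> S (env_h p * a).
  elim/fp_ind: p a; elim=> [i|c|s IHs t IHt|s IHs t IHt|s IHs t IHt] a Sa.
  - exact: Sh.
  (* Here h_c = c h_1 = 0, and 0 lies in [S] as the multiple [0 *: a]. *)
  - rewrite fp_piC linearZ /= h1 scaler0 mul0r -(scale0r a); exact: SZ.
  - by rewrite fp_piD linearD mulrDl; apply: SD; [apply: IHs | apply: IHt].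
  - rewrite fp_piM env_hM mulrDl -!mulrA.
    by apply: SD; apply: Sm; [apply: IHs | apply: IHt].
  - have -> : fp_pi (PBracket s t) = bracket (fp_pi s) (fp_pi t) :> P.
      by rewrite /bracket /= fp_bracketE.
    rewrite env_h_bracket mulrBl -!mulrA.
    by apply: SB; [apply/IHs/IHt | apply/IHt/IHs].
have Smul a b : S b -> S (a * b).
  elim/env_ind: a b; elim=> [p|p|c|s IHs t IHt|s IHs t IHt] b Sb.
  - exact: Sm.
  - exact: SH.
  - exact: SZ.
  - by rewrite env_piD mulrDl; apply: SD; [apply: IHs | apply: IHt].
  - by rewrite env_piM -mulrA; apply/IHs/IHt.
by move=> a; rewrite -[a]mulr1; apply: Smul.
Qed.

(** * The isomorphism of P^e with the monoid algebra [W] *)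

Definition env_to_malg : envelope_mod P -> W := env_eval1 fp_der.

Lemma env_to_malg_linear : linear env_to_malg.
Proof. exact: (env_eval1_linear fp_derD fp_derZ fp_derM fp_der_bracket). Qed.

HB.instance Definition _ := GRing.isLinear.Build P (envelope_mod P) W *:%R
  env_to_malg env_to_malg_linear.

(** Since [der] kills words and D x_i = X_i, each factor [h i] puts the letter i in front of the
    word. *)
Lemma env_to_malg_word m : env_to_malg (fmonom_prod h m) = << m >>.
Proof.
case: m; elim=> [|i r IHr].
  rewrite -fmoneE [X in env_to_malg X]fmonom_prod1.
  exact: (env_dact1 fp_derD fp_derZ fp_derM fp_der_bracket).
have -> : FMonom (i :: r) = mmul (fmu i) (FMonom r).
  by apply: val_inj; rewrite /= fmM fmU.
rewrite fmonom_prodM fmonom_prodU /env_to_malg /env_eval1.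
rewrite (env_dactM fp_derD fp_derZ fp_derM fp_der_bracket).
rewrite [env_dact _ _ 1]IHr (env_dact_h fp_derD fp_derZ fp_derM fp_der_bracket).
by rewrite [der _ _]mbracketU1 add0r fp_der_var malgUM mulr1.
Qed.

Definition malg_to_env : W -> envelope_mod P :=
  malg_lift (fmonom_prod h : _ -> envelope_mod P).

HB.instance Definition _ := GRing.Linear.on malg_to_env.

Lemma malg_to_envD u v : malg_to_env (u + v) = malg_to_env u + malg_to_env v.
Proof. exact: linearD. Qed.

Lemma malg_to_envU p m :
  malg_to_env << p *g m >> = env_m p * fmonom_prod h m :> U.
Proof. by rewrite [LHS]malg_liftU. Qed.

Lemma malg_to_envK : cancel malg_to_env env_to_malg.
Proof.
apply: (@eq_malg_linear _ _ _ (env_to_malg \o malg_to_env) idfun) => m.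
by rewrite /= /malg_to_env malg_lift1 env_to_malg_word.
Qed.

Lemma malg_to_env_surj (a : envelope_mod P) : exists u, malg_to_env u = a.
Proof.
apply: (@env_spanning_left_ideal (fun a => exists u, malg_to_env u = a)).
- by move=> _ _ [u <-] [v <-]; exists (u + v); rewrite linearD.
- by move=> p _ [u <-]; exists (p *: u); rewrite linearZ.
- move=> i _ [u <-]; elim/malg_ind: u => [p m|u v [u' u'E] [v' v'E]]; last first.
    by exists (u' + v'); rewrite !malg_to_envD mulrDr u'E v'E.
  (* The witness comes from h_x m_p = m_{x,p} + m_p h_x with x = x_i, which moves [h i] past the
     coefficient. *)
  exists (<< bracket (var i) p *g m >> + << p *g mmul (fmu i) m >>).
  rewrite [LHS]malg_to_envD (malg_to_envU (bracket (var i) p) m).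
  rewrite (malg_to_envU p (mmul (fmu i) m)) (malg_to_envU p m).
  rewrite fmonom_prodM fmonom_prodU.
  by rewrite env_m_bracket !mulrA -mulrDl subrK.
- by exists 1; rewrite /malg_to_env malg_lift1 fmonom_prod1.
Qed.

Lemma env_to_malgK : cancel env_to_malg malg_to_env.
Proof. by move=> a; have [u <-] := malg_to_env_surj a; rewrite malg_to_envK. Qed.

(** * Freeness of the subalgebra [A] *)

Let A : algType k := gen_subalg h.
Let free_to_A : {malg k[{fmonom 'I_n}]} -> A := free_lift (subalg_gen h).

Lemma env_to_malg_freeU (c : k) m :
  env_to_malg (val (free_to_A << c *g m >>)) = << c%:A *g m >>.
Proof.
rewrite /free_to_A /free_lift malg_liftU linearZ /= val_fmonom_prod.
have -> : c *: fmonom_prod h m = env_m c%:A * fmonom_prod h m.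
  by rewrite rmorph_alg mulr_algl.
by rewrite -malg_to_envU malg_to_envK.
Qed.

Lemma env_to_malg_freeD b b' :
  env_to_malg (val (free_to_A (b + b'))) =
  env_to_malg (val (free_to_A b)) + env_to_malg (val (free_to_A b')).
Proof. by rewrite /free_to_A !raddfD. Qed.

(** [env_to_malg] carries [A] to the elements of [W] with constant coefficients, so the coefficients
    of [b] can be read off from its image in [A]. *)
Lemma mcoeff_env_to_malg_free b m :
  (env_to_malg (val (free_to_A b)))@_m = (b@_m)%:A.
Proof.
elim/malg_ind: b => [c m'|u v IHu IHv].
  rewrite env_to_malg_freeU !mcoeffU.
  by case: eqP; rewrite ?mulr1n // !mulr0n scale0r.
by rewrite env_to_malg_freeD mcoeffD IHu IHv mcoeffD scalerDl.
Qed.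

Lemma free_to_A_inj : injective free_to_A.
Proof.
(* The constants embed into [P], as a field maps injectively into a nonzero ring. *)
move=> b b' bb'; apply/malgP => m; apply: (fmorph_inj (in_alg P)).
by rewrite /= -!mcoeff_env_to_malg_free bb'.
Qed.

(** * The isomorphism of P^e with the tensor product of [P] and [A] *)

Definition malg_to_tens : W -> tens P A :=
  malg_lift (fun m => tensor 1 (fmonom_prod (subalg_gen h) m)).

HB.instance Definition _ := GRing.Linear.on malg_to_tens.

Lemma malg_to_tensD u v : malg_to_tens (u + v) = malg_to_tens u + malg_to_tens v.
Proof. exact: linearD. Qed.

Lemma malg_to_tensU p m :
  malg_to_tens << p *g m >> = tensor p (fmonom_prod (subalg_gen h) m).
Proof. by rewrite [LHS]malg_liftU scale_tensor mulr1. Qed.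

(** On monomials the constant coefficient of [b] moves across the tensor sign by [tensorZ];
    additivity does the rest. *)
Lemma malg_to_tens_free p b :
  malg_to_tens (p *: env_to_malg (val (free_to_A b))) = tensor p (free_to_A b).
Proof.
elim/malg_ind: b => [c m|u v IHu IHv].
  rewrite env_to_malg_freeU malgZU malg_to_tensU mulr_algr tensorZ.
  by rewrite /free_to_A /free_lift malg_liftU.
rewrite env_to_malg_freeD scalerDr [LHS]malg_to_tensD.
rewrite [X in tensor _ X](_ : _ = free_to_A u + free_to_A v) ?tensorDr.
  by congr (_ + _); [exact: IHu | exact: IHv].
exact: (raddfD (free_lift (subalg_gen h))).
Qed.

Definition env_to_tens : envelope_mod P -> tens P A := malg_to_tens \o env_to_malg.

HB.instance Definition _ := GRing.Linear.on env_to_tens.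

Lemma env_to_tens_bij : bijective env_to_tens.
Proof.
(* The inverse is induced by the balanced map that sends (p, a) to m_p a. *)
have [| | |t2e [t2eE _]] := @tens_universal k P A (envelope_mod P)
  (fun p a => env_m p * val a).
- by move=> p q a; rewrite linearD mulrDl.
- by move=> p a b; rewrite linearD mulrDr.
- by move=> c p a; rewrite !linearZ /= -scalerAl -scalerAr.
(* An additive endomorphism that fixes all pure tensors equals [F]; this applies both to the
   composite and to the identity. *)
have [| | |F [_ F_uniq]] := @tens_universal k P A (tens P A) (@tensor k P A).
- exact: tensorDl.
- exact: tensorDr.
- exact: tensorZ.
exists t2e.
  move=> a; rewrite /env_to_tens /= -{2}[a]env_to_malgK.
  elim/malg_ind: (env_to_malg a) => [p m|u v IHu IHv].
    by rewrite malg_to_tensU t2eE malg_to_envU val_fmonom_prod.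
  by rewrite malg_to_envD linearD raddfD IHu IHv.
move=> x; have -> : env_to_tens (t2e x) = F x.
  apply: (F_uniq (env_to_tens \o t2e)) => p a /=.
  have [b <-] := free_lift_surj a.
  rewrite t2eE /env_to_tens /= -[RHS]malg_to_tens_free.
  by rewrite -linearZ.
by rewrite -(F_uniq idfun).
Qed.

End FreePoissonEnvelope.

Theorem theorem2 (k : fieldType) (char0 : [pchar k] =i pred0) (n : nat) :
  let P : poissonType k := freePoisson k n in
  let A : algType k := gen_subalg (fun i : 'I_n => env_h (fp_var k i : P)) in
  (exists f : {lrmorphism {malg k[{fmonom 'I_n}]} -> A},
     bijective f /\
     forall i : 'I_n, val (f << fmu i >>) = env_h (fp_var k i : P)) /\
  (exists g : {linear envelope_mod P -> tens P A}, bijective g).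
Proof.
move=> P A; split; last by exists (@env_to_tens k n); exact: env_to_tens_bij.
exists (free_lift (subalg_gen (fun i => env_h (fp_var k i : P)))); split; last first.
  by move=> i; exact: (congr1 val (free_liftU _ i)).
(* A preimage chosen by surjectivity; injectivity makes this choice a two-sided inverse. *)
pose inv (a : A) := boolp.cid (free_lift_surj a).
exists (fun a => sval (inv a)) => [b|a]; last exact: svalP (inv a).
by apply: free_to_A_inj; exact: svalP (inv _).
Qed.
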